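(* Let $\mathbf g=(g_1,\dots,g_s)\subset\mathbb R[\mathbf X]$, $Q=\mathcal Q(\mathbf g)$ and $J=\sqrt[\mathbb R]{\operatorname{supp}Q}$. Then there exist $t,k\in\mathbb N$ with $t\le k$ such that for every $\sigma^*$ generic in $\mathcal L_{2k}(\mathbf g)$, the ideal of $\mathbb R[\mathbf X]$ generated by $\ker H^t_{\sigma^*}$ equals $J$.
   Context: $\mathbb R[\mathbf X]=\mathbb R[X_1,\dots,X_n]$; $\mathbb R[\mathbf X]_t$ is the space of polynomials of degree $\le t$. $\Sigma^2$ is the cone of sums of squares, $\Sigma^2_t=\Sigma^2\cap\mathbb R[\mathbf X]_t$. For a finite family $G$, $\mathcal Q_t(G)=\{s_0+\sum_{g\in G}s_g g: s_0\in\Sigma^2_t,\ s_g\in\Sigma^2,\ \deg s_g\le t-\deg g\}$ and $\mathcal Q(G)=\bigcup_t\mathcal Q_t(G)$. $\mathcal L_t(G)=\{\sigma\in(\mathbb R[\mathbf X]_t)^*:\sigma(q)\ge0\ \forall q\in\mathcal Q_t(G)\}$. $\operatorname{supp}Q=Q\cap(-Q)$; the real radical of an ideal $I$ is $\sqrt[\mathbb R]{I}=\{f:\exists m\in\mathbb N, s\in\Sigma^2, f^{2m}+s\in I\}$. For $\sigma\in(\mathbb R[\mathbf X]_r)^*$ and $2t\le r$, the Hankel operator $H^t_\sigma:\mathbb R[\mathbf X]_t\to(\mathbb R[\mathbf X]_t)^*$ is $H^t_\sigma(p)(q)=\sigma(pq)$; its kernel is a subspace of $\mathbb R[\mathbf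 X]_t$. For a set $C\subseteq(\mathbb R[\mathbf X]_{2k})^*$, an element $\sigma\in C$ is generic in $C$ if for every $s\le k$ and every $\eta\in C$, $\ker H^s_\sigma\subseteq\ker H^s_\eta$ (for convex cones $\mathcal L_{2k}(\mathbf g)$ this is equivalent to $H^k_\sigma$ having maximal rank). *)

(* Defs.v *)
From HB Require Import structures.
From mathcomp Require Import all_boot all_algebra.
From mathcomp Require Import mpoly.
From mathcomp Require Import Rstruct.
From Stdlib Require Import Rdefinitions.

Set Implicit Arguments.
Unset Strict Implicit.
Unset Printing Implicit Defensive.

Import GRing.Theory.
Local Open Scope ring_scope.

Notation RX n := {mpoly R[n]}.

(* total degree; deg 0 = 0 here, msize 0 = 0 distinguishes the zero poly *)
Definition tdeg n (p : RX n) : nat := (msize p).-1.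

Definition degle n (t : nat) (p : RX n) : Prop := leq (msize p) t.+1.

Definition sos n (p : RX n) : Prop :=
  exists l : seq (RX n), p = \sum_(q <- l) q ^+ 2.

Definition sos_t n (t : nat) (p : RX n) : Prop := sos p /\ degle t p.

Definition Qt n s (g : 'I_s -> RX n) (t : nat) (q : RX n) : Prop :=
  exists (s0 : RX n) (sg : 'I_s -> RX n),
    [/\ sos_t t s0,
        (forall i, sos (sg i) /\ (sg i = 0 \/ leq (tdeg (sg i) + tdeg (g i)) t))
      & q = s0 + \sum_(i < s) sg i * g i].

Definition QM n s (g : 'I_s -> RX n) (q : RX n) : Prop := exists t, Qt g t q.

Definition suppQ n s (g : 'I_s -> RX n) (f : RX n) : Prop := QM g f /\ QM g (- f).

Definition real_radical n (I : RX n -> Prop) (f : RX n) : Prop :=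
  exists (m : nat) (sq : RX n), sos sq /\ I (f ^+ (2 * m) + sq).

(* elements of (R[X]_t)^* : functions on R[X] that are R-linear on R[X]_t;
   their values outside R[X]_t are irrelevant junk. *)
Definition lin_on n (t : nat) (sigma : RX n -> R) : Prop :=
  forall (a : R) (p q : RX n), degle t p -> degle t q ->
    sigma (a *: p + q) = a * sigma p + sigma q.

Definition Lt n s (g : 'I_s -> RX n) (t : nat) (sigma : RX n -> R) : Prop :=
  lin_on t sigma /\ forall q, Qt g t q -> 0 <= sigma q.

Definition kerH n (t : nat) (sigma : RX n -> R) (p : RX n) : Prop :=
  degle t p /\ forall q, degle t q -> sigma (p * q) = 0.

(* sigma generic in C ⊆ (R[X]_{2k})^* *)
Definition generic_in n (k : nat) (C : (RX n -> R) -> Prop) (sigma : RX n -> R) : Prop :=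
  C sigma /\
  forall (s : nat) (eta : RX n -> R), leq s k -> C eta ->
    forall p, kerH s sigma p -> kerH s eta p.

Definition ideal_gen n (S : RX n -> Prop) (f : RX n) : Prop :=
  exists l : seq (RX n * RX n),
    (forall x, x \in l -> S x.2) /\ f = \sum_(x <- l) x.1 * x.2.

(* Main.v *)
Require Import Defs.
From mathcomp Require Import all_boot all_order all_algebra.
From mathcomp Require Import mpoly.
From mathcomp Require Import Rstruct.
From mathcomp Require Import boolp classical_sets reals.
From Stdlib Require Import Rdefinitions.
From mathcomp Require Import ring lra zify.

Set Implicit Arguments.
Unset Strict Implicit.
Unset Printing Implicit Defensive.

Import Order.TTheory GRing.Theory Num.Theory.
(* The key N otherwise denotes Stdlib's scope of binary naturals. *)
Delimit Scope nat_scope with N.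
Local Open Scope ring_scope.

(* J is also the ordinary radical of supp Q, and it is convex: if a, b lie in Q and
   a + b lies in J, then so does a. By Hilbert's basis theorem J is generated by
   polynomials f of degree at most t. A power f^(2^a) with a > 0 is a square lying in
   -Q, so for k large every sigma in L_2k kills it, and by Cauchy-Schwarz f is in the
   kernel of the Hankel operator.

   Conversely it suffices to find one eta in L_2k with eta(p^2) > 0 for all p of degree
   at most k outside J, since a generic sigma has the smallest kernel. Modulo J, the
   truncated quadratic module is the cone generated by the values B(x, x) of a
   vector-valued symmetric bilinear map on the space E of tuples of polynomials, and a
   sum of such values vanishes only if all x are in the radical of B. The functional is
   found without topology by induction on subspaces F of E: M. Riesz extension gives
   eta0 >= 0, not identically zero, on the cone of F; the induction hypothesis gives eta1
   positive on the kernel of the form eta0 B; by Finsler's lemma a eta0 + eta1 is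
   positive on F for some a. *)

(** * Extension of positive functionals in finite dimension *)

Section PositiveFunctionals.
Variable R : realType.

(** Used to choose the value of an extended functional on a new coordinate. The supremum of A
    serves; if A and B are both empty, any number does. *)
Lemma real_between (A B : R -> Prop) :
  (forall a b, A a -> B b -> a <= b) ->
  ((exists a, A a) <-> (exists b, B b)) ->
  exists t, (forall a, A a -> a <= t) /\ (forall b, B b -> t <= b).
Proof.
move=> AB neAB; have [[a Aa]|nA] := pselect (exists a, A a); last first.
  have nB : ~ exists b, B b by move/neAB.
  by exists 0; split=> [a Aa|b Bb]; [case: nA; exists a|case: nB; exists b].
have [b Bb] : exists b, B b by apply/neAB; exists a.
exists (sup A); split=> [x Ax|x Bx].
  apply: sup_upper_bound => //; split; first by exists a.
  by exists b => y Ay; exact: AB.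
by apply: ge_sup; [exists a|move=> y Ay; exact: AB].
Qed.

(** The functional is extended from the line of e one coordinate at a time; the order unit e makes
    lower and upper bounds on each new value exist together. *)
Lemma riesz_extension D (C : 'rV[R]_D -> Prop) (e : 'rV[R]_D) :
  (forall u v, C u -> C v -> C (u + v)) ->
  (forall a u, 0 <= a -> C u -> C (a *: u)) ->
  C e -> (forall u, C u -> exists a, C (a *: e - u)) -> ~ C (- e) ->
  exists t : 'I_D -> R, (forall u, C u -> 0 <= \sum_i u 0 i * t i) /\
                        \sum_i e 0 i * t i = 1.
Proof.
move=> CD CZ Ce Cunit Cne.
pose dot (c : 'rV[R]_D) (t : 'I_D -> R) := \sum_i c 0 i * t i.
have dotD t c d : dot (c + d) t = dot c t + dot d t.
  by rewrite -big_split; apply: eq_bigr => i _; rewrite mxE mulrDl.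
have dotZ t a c : dot (a *: c) t = a * dot c t.
  by rewrite mulr_sumr; apply: eq_bigr => i _; rewrite mxE mulrA.
have dotN t c : dot (- c) t = - dot c t by rewrite -scaleN1r dotZ mulN1r.
have dot0 t : dot 0 t = 0 by rewrite -(scale0r 0) dotZ mul0r.
(* Here e counts as a formal extra direction of value 1, although [a *: e + c] need not determine
   the pair (a, c); consistency is settled at the end. *)
have H j : (j <= D)%N -> exists t : 'I_D -> R, forall (a : R) (c : 'rV[R]_D),
    (forall i : 'I_D, (j <= i)%N -> c 0 i = 0) -> C (a *: e + c) -> 0 <= a + dot c t.
  elim: j => [_|j IHj ltjD].
    exists (fun=> 0) => a c c0; have -> : c = 0.
      by apply/rowP => i; rewrite c0 // mxE.
    rewrite dot0 !addr0 => Ca; rewrite leNgt; apply/negP => a_lt0.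
    apply: Cne; have -> : - e = (- a^-1) *: (a *: e).
      by rewrite scalerA mulNr mulVf ?scaleN1r // lt_eqF.
    by apply: CZ => //; rewrite oppr_ge0 invr_le0 ltW.
  have {IHj} [t tP] := IHj (ltnW ltjD); pose J := Ordinal ltjD.
  pose d : 'rV[R]_D := delta_mx 0 J.
  (* Nonnegativity at vectors with coefficient 1 or -1 on d bounds x from below or from above. *)
  have [x [xA xB]] : exists x,
     (forall a, (exists (l : R) (c : 'rV[R]_D),
         [/\ forall i : 'I_D, (j <= i)%N -> c 0 i = 0,
             C (l *: e + c + d) & a = - (l + dot c t)]) -> a <= x) /\
     (forall a, (exists (l : R) (c : 'rV[R]_D),
         [/\ forall i : 'I_D, (j <= i)%N -> c 0 i = 0,
             C (l *: e + c - d) & a = l + dot c t]) -> x <= a).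
    apply: real_between.
      move=> a b [l [c [c0 Cc ->]]] [l' [c' [c0' Cc' ->]]].
      have : 0 <= (l + l') + dot (c + c') t.
        apply: tP => [i ji|]; first by rewrite mxE c0 // c0' // addr0.
        have -> : (l + l') *: e + (c + c') = (l *: e + c + d) + (l' *: e + c' - d).
          by rewrite scalerDl [RHS]addrACA subrr addr0 addrACA.
        exact: CD.
      by rewrite dotD; lra.
    (* Subtraction from a multiple of the order unit exchanges the vectors with + d and those with -
       d. *)
    split=> -[_ [l [c [c0 Cc _]]]]; have [a Ca] := Cunit _ Cc.
      exists (a - l + dot (- c) t), (a - l), (- c); split=> // [i ji|].
        by rewrite mxE c0 // oppr0.
      by move: Ca; rewrite scalerBl !opprD !addrA.
    exists (- (a - l + dot (- c) t)), (a - l), (- c); split=> // [i ji|].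
      by rewrite mxE c0 // oppr0.
    by move: Ca; rewrite scalerBl !opprD !addrA opprK.
  exists (fun i => if i == J then x else t i) => a c c0 Cc.
  pose c1 := c - c 0 J *: d.
  have c10 (i : 'I_D) : (j <= i)%N -> c1 0 i = 0.
    move=> ji; rewrite !mxE eqxx /=; have [->|neq] := eqVneq i J.
      by rewrite mulr1 subrr.
    rewrite mulr0 subr0 c0 // ltn_neqAle ji andbT.
    by apply: contra neq => /eqP eji; apply/eqP/val_inj.
  have cE : c = c1 + c 0 J *: d by rewrite subrK.
  have -> : dot c (fun i => if i == J then x else t i) = dot c1 t + c 0 J * x.
    rewrite {1}cE dotD dotZ; congr (_ + _ * _).
      apply: eq_bigr => i _; have [->|//] := eqVneq i J.
      by rewrite c10 ?mul0r.
    rewrite /dot (bigD1 J) //= big1 ?addr0 => [|i neq].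
      by rewrite mxE !eqxx mul1r.
    by rewrite mxE (negPf neq) andbF mul0r.
  (* Unless y = 0, division by its absolute value reduces to coefficient 1 or -1. *)
  move: (c 0 J) cE => y cE; have [y0|y0|y0] := ltgtP y 0.
  - have y0' : 0 <= (- y)^-1 by rewrite invr_ge0 oppr_ge0 ltW.
    have := xB ((- y)^-1 * (a + dot c1 t)) _; rewrite ler_pdivlMl ?oppr_gt0 //.
    move=> H; suff : - y * x <= a + dot c1 t by lra.
    apply: H; exists ((- y)^-1 * a), ((- y)^-1 *: c1).
    split=> [i ji||]; first by rewrite mxE c10 // mulr0.
      have := CZ _ _ y0' Cc; rewrite {1}cE !scalerDr !scalerA invrN mulNr.
      by rewrite [X in _ + (_ + X *: _)]mulNr mulVf ?lt_eqF // scaleN1r addrA.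
    by rewrite dotZ mulrDr.
  - have y0' : 0 <= y^-1 by rewrite invr_ge0 ltW.
    have := xA (- (y^-1 * a + dot (y^-1 *: c1) t)) _.
    rewrite dotZ -mulrDr => H.
    have {}H : - (y^-1 * (a + dot c1 t)) <= x.
      apply: H; exists (y^-1 * a), (y^-1 *: c1).
      split=> [i ji||]; first by rewrite mxE c10 // mulr0.
        have := CZ _ _ y0' Cc; rewrite {1}cE !scalerDr !scalerA.
        by rewrite mulVf ?gt_eqF // scale1r addrA.
      by rewrite dotZ mulrDr.
    have := ler_wpM2l (ltW y0) H; rewrite mulrN mulrA divff ?gt_eqF // mul1r.
    by lra.
  - rewrite y0 mul0r addr0; apply: tP => //.
    by move: Cc; rewrite {1}cE y0 scale0r addr0.
have [t tP] := H D (leqnn D); exists t.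
have tP' (a : R) (c : 'rV[R]_D) : C (a *: e + c) -> 0 <= a + dot c t.
  by apply: tP => i; rewrite leqNgt ltn_ord.
have C0 : C 0 by rewrite -(scale0r e); exact: CZ.
split=> [u Cu|]; first by rewrite -(add0r (\sum_i _)); apply: tP'; rewrite scale0r add0r.
(* The pairs (1, - e) and (- 1, e) both represent 0, which lies in C; they give the two
   inequalities. *)
apply/eqP; rewrite eq_le; apply/andP; split.
  have := tP' 1 (- e); rewrite scale1r subrr dotN subr_ge0; exact.
have := tP' (- 1) e; rewrite scaleN1r addNr addrC subr_ge0; exact.
Qed.

(** G has maximal dimension among the subspaces of F on which P holds; any further such vector could
    be added to it. *)
Lemma vspace_of_pred (E : vectType R) (F : {vspace E}) (P : E -> Prop) :
  P 0 -> (forall a x y, P x -> P y -> P (a *: x + y)) ->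
  exists G : {vspace E}, forall x, x \in G <-> x \in F /\ P x.
Proof.
move=> P0 Plin.
pose Q n := `[< exists G : {vspace E},
   [/\ (G <= F)%VS, forall x, x \in G -> P x & \dim G = n] >].
have exQ : exists n, Q n.
  exists 0%N; apply/asboolP; exists 0%VS; split; rewrite ?sub0v ?dimv0 //.
  by move=> x; rewrite memv0 => /eqP ->.
have ubQ n : Q n -> (n <= \dim F)%N by move=> /asboolP [G [GF _ <-]]; exact: dimvS.
case: (ex_maxnP exQ ubQ) => n /asboolP [G [GF GP <-]] maxG; exists G => x.
split=> [xG|[xF Px]]; first by split; [exact: (subvP GF)|exact: GP].
have GGx : (G <= G + <[x]>)%VS by exact: addvSl.
suff dimG : (\dim (G + <[x]>) <= \dim G)%N.
  have /eqP -> : G == (G + <[x]>)%VS by rewrite eqEdim GGx.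
  exact: (subvP (addvSr _ _)) (memv_line x).
apply: maxG; apply/asboolP; exists (G + <[x]>)%VS; split=> //.
  by rewrite subv_add GF -memvE.
move=> y /memv_addP [u uG [_ /vlineP [a ->] ->]].
by rewrite addrC; apply: Plin => //; exact: GP.
Qed.

Definition symbilinear (E : vectType R) (V : lmodType R) (b : E -> E -> V) :=
  (forall x y, b x y = b y x) /\
  (forall a x y z, b (a *: x + y) z = a *: b x z + b y z).

Section Forms.
Variables (E : vectType R) (V : lmodType R) (b : E -> E -> V).
Hypothesis bP : symbilinear b.

Lemma symbilDl x y z : b (x + y) z = b x z + b y z.
Proof. by have := bP.2 1 x y z; rewrite !scale1r. Qed.

Lemma symbil0l z : b 0 z = 0.
Proof. by apply: (addIr (b 0 z)); rewrite -symbilDl !add0r. Qed.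

Lemma symbilZl a x z : b (a *: x) z = a *: b x z.
Proof. by rewrite -[a *: x]addr0 bP.2 symbil0l addr0. Qed.

Lemma symbilDr x y z : b z (x + y) = b z x + b z y.
Proof. by rewrite bP.1 symbilDl !(bP.1 z). Qed.

Lemma symbilZr a x z : b z (a *: x) = a *: b z x.
Proof. by rewrite bP.1 symbilZl bP.1. Qed.

Lemma symbil0r z : b z 0 = 0.
Proof. by rewrite bP.1 symbil0l. Qed.

End Forms.

(** * Positive semidefinite forms and Finsler's lemma *)

Section RealForms.
Variable E : vectType R.
Implicit Types (b : E -> E -> R^o) (F G : {vspace E}).

(** For isotropic k the form is affine in c along v + c k, so it stays nonnegative only if the slope
    2 b(v, k) is zero. *)
Lemma psd_radical b F : symbilinear b -> (forall x, x \in F -> 0 <= b x x) ->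
  forall v k, v \in F -> k \in F -> b k k = 0 -> b v k = 0.
Proof.
move=> bP bF v k vF kF bk; apply/eqP/negPn/negP => nz.
(* The coefficient of k is solved so that the form takes the value -1. *)
have := bF (v + (- (b v v + 1) / (2 * b v k)) *: k) _.
rewrite rpredD ?rpredZ // => /(_ isT).
rewrite !(symbilDl bP, symbilDr bP, symbilZl bP, symbilZr bP) bk (bP.1 k v).
rewrite /GRing.scale /= !mulr0 addr0 (_ : _ + _ = - 1); last by field.
by rewrite oppr_ge0 ler10.
Qed.

(** Gram-Schmidt along the list, for a form that may be degenerate. *)
Lemma psd_projection b (l : seq E) : symbilinear b ->
  (forall x, x \in <<l>>%VS -> 0 <= b x x) ->
  forall v, (forall k, k \in <<l>>%VS -> b k k = 0 -> b v k = 0) ->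
  exists2 u, u \in <<l>>%VS & forall w, w \in <<l>>%VS -> b (v + u) w = 0.
Proof.
move=> bP; elim: l => [|w0 l IHl] bl v vl.
  by exists 0 => [|w]; rewrite span_nil ?mem0v // memv0 => /eqP ->; rewrite symbil0r.
have sub x : x \in <<l>>%VS -> x \in <<w0 :: l>>%VS.
  by rewrite span_cons; exact: (subvP (addvSr _ _)).
have w0in : w0 \in <<w0 :: l>>%VS by rewrite memv_span ?mem_head.
have bl' x : x \in <<l>>%VS -> 0 <= b x x by move=> /sub /bl.
have [u1 u1l u1P] := IHl bl' w0 (fun k kl => psd_radical bP bl w0in (sub _ kl)).
have [u2 u2l u2P] := IHl bl' v (fun k kl => vl k (sub _ kl)).
set w1 := w0 + u1 in u1P; set v1 := v + u2 in u2P.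
have w1in : w1 \in <<w0 :: l>>%VS by rewrite /w1 rpredD // sub.
(* An isotropic [w1] needs no correction: v is orthogonal to it by hypothesis, and [u2] by the
   choice of [u1]. *)
pose c := if b w1 w1 == 0 then 0 else - b v1 w1 / b w1 w1.
have vw1 : b (v1 + c *: w1) w1 = 0.
  rewrite symbilDl // symbilZl // /c; case: eqP => [w10|/eqP nz].
    rewrite scale0r addr0 symbilDl // (vl _ w1in w10) add0r bP.1.
    exact: u1P.
  by rewrite /GRing.scale /= divfK // subrr.
exists (u2 + c *: w1); first by rewrite rpredD // ?rpredZ // sub.
move=> w; rewrite span_cons => /memv_addP [_ /vlineP [a ->] [u ul ->]].
rewrite addrA -/v1 (_ : a *: w0 + u = a *: w1 + (u - a *: u1)); last first.
  by rewrite /w1 scalerDr -addrA [a *: u1 + _]addrC subrK.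
rewrite symbilDr // symbilZr // vw1 scaler0 add0r.
have ul' : u - a *: u1 \in <<l>>%VS by rewrite rpredB ?rpredZ.
by rewrite symbilDl // symbilZl // u2P // u1P // scaler0 addr0.
Qed.

(* Finsler's lemma, modulo a common radical N of the two forms. *)
Lemma finsler b0 b1 F F' (N : E -> Prop) :
  symbilinear b0 -> symbilinear b1 -> (F' <= F)%VS ->
  (forall x, x \in F -> 0 <= b0 x x) ->
  (forall x, x \in F -> b0 x x = 0 -> x \in F') ->
  (forall x, N x -> forall y, b0 x y = 0 /\ b1 x y = 0) ->
  (forall x, x \in F' -> ~ N x -> 0 < b1 x x) ->
  exists a, forall x, x \in F -> ~ N x -> 0 < a * b0 x x + b1 x x.
Proof.
move=> b0P b1P sF' psd0 ker0 NP pos1.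
(* The subspace grows from F' to F by one basis vector of F at a time, with a adjusted at each
   stage. *)
suff H (l : seq E) : {subset l <= F} -> exists a, forall x,
    x \in (<<l>> + F')%VS -> ~ N x -> 0 < a * b0 x x + b1 x x.
  have [a aP] := H (vbasis F) (fun=> @vbasis_mem _ _ _ F); exists a => x xF; apply: aP.
  by rewrite (span_basis (vbasisP F)); exact: (subvP (addvSl _ _)).
elim: l => [|v l IHl] sl.
  exists 0 => x; rewrite span_nil add0v mul0r add0r; exact: pos1.
have vF : v \in F by apply: sl; rewrite mem_head.
have {}sl : {subset l <= F} by move=> y yl; apply: sl; rewrite in_cons yl orbT.
have {IHl} [a aP] := IHl sl; set G := (<<l>> + F')%VS in aP *.
have GF : (G <= F)%VS by rewrite subv_add sF' andbT; exact/span_subvP.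
have GFx x : x \in G -> x \in F by exact: (subvP GF).
have memG x : x \in (<<v :: l>> + F')%VS -> exists c, exists2 w, w \in G & x = c *: v + w.
  rewrite span_cons -addvA => /memv_addP [_ /vlineP [c ->] [w wG ->]].
  by exists c, w.
have [vG|vG] := boolP (v \in G).
  exists a => x /memG [c [w wG ->]]; apply: aP; by rewrite rpredD ?rpredZ.
pose B x y : R^o := a *: b0 x y + b1 x y.
have BP : symbilinear B.
  split=> [x y|c x y z]; rewrite /B; first by rewrite b0P.1 b1P.1.
  rewrite b0P.2 b1P.2 !scalerDr !scalerA (mulrC a c); exact: addrACA.
have BN x y : N x -> B x y = 0.
  by move=> Nx; rewrite /B (NP _ Nx y).1 (NP _ Nx y).2 scaler0 addr0.
have B_ge0 x : x \in G -> 0 <= B x x.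
  move=> xG; have [/BN ->|Nx] := pselect (N x) => //; exact/ltW/aP.
have B_ker x : x \in G -> B x x = 0 -> B v x = 0.
  move=> xG Bx; have [/BN Nx|Nx] := pselect (N x); first by rewrite BP.1.
  by move: (aP x xG Nx); rewrite -[_ + _]/(B x x) Bx ltxx.
have spanG : <<vbasis G>>%VS = G by exact: span_basis (vbasisP G).
(* The vector v is made orthogonal to G twice, for [b0] by [u0] and for B by [u1]; each splitting
   bounds its own form from below at [c *: v + w]. *)
have [u0] : exists2 u, u \in G & forall w, w \in G -> b0 (v + u) w = 0.
  rewrite -spanG; apply: psd_projection => // [x|x]; rewrite spanG.
    by move=> /GFx; exact: psd0.
  by move=> /GFx xF; exact: (psd_radical b0P psd0).
have [u1] : exists2 u, u \in G & forall w, w \in G -> B (v + u) w = 0.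
  by rewrite -spanG; apply: psd_projection => // [x|x]; rewrite spanG; [exact: B_ge0|exact: B_ker].
set v1 := v + u1 => u1G Bv1; set v0 := v + u0 => u0G bv0.
have v0F : v0 \in F by rewrite /v0 rpredD // GFx.
(* Otherwise [v0] would lie in F', hence in G, and so would v. *)
have bv0_gt0 : 0 < b0 v0 v0.
  rewrite lt_neqAle psd0 // andbT eq_sym; apply/negP => /eqP /(ker0 _ v0F) v0F'.
  move: vG; rewrite -(addrK u0 v) -/v0 rpredB //.
  exact: (subvP (addvSr _ _)).
have expand (b : E -> E -> R^o) u x c : symbilinear b -> (forall w, w \in G -> b u w = 0) ->
    x \in G -> b (c *: u + x) (c *: u + x) = c ^+ 2 * b u u + b x x.
  move=> bP uG xG; rewrite !(symbilDl bP, symbilDr bP, symbilZl bP, symbilZr bP).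
  by rewrite (bP.1 x u) (uG x xG) !scaler0 addr0 add0r scalerA -expr2.
(* With this m, the gain [m * b0 v0 v0] exceeds any negative contribution of [B v1 v1] by at least
   1. *)
pose m := (`|B v1 v1| + 1) / b0 v0 v0.
have m_ge0 : 0 <= m by rewrite divr_ge0 ?addr_ge0 // ltW.
exists (m + a) => x xl Nx; rewrite mulrDl -addrA -[a * _ + _]/(B x x).
have xF : x \in F.
  by have [c [w wG ->]] := memG _ xl; rewrite rpredD // ?rpredZ // GFx.
have [c [w wG xE]] := memG _ xl; have [c0|c0] := eqVneq c 0.
  rewrite c0 scale0r add0r in xE; have : 0 < B x x by apply: aP; rewrite ?xE // -xE.
  by move: (mulr_ge0 m_ge0 (psd0 _ xF)); lra.
have bx : c ^+ 2 * b0 v0 v0 <= b0 x x.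
  have -> : x = c *: v0 + (w - c *: u0).
    by rewrite xE /v0 scalerDr -addrA [c *: u0 + _]addrC subrK.
  have wG' : w - c *: u0 \in G by rewrite rpredB ?rpredZ.
  by rewrite expand // lerDl; apply: psd0; exact: GFx.
have Bx : c ^+ 2 * B v1 v1 <= B x x.
  have -> : x = c *: v1 + (w - c *: u1).
    by rewrite xE /v1 scalerDr -addrA [c *: u1 + _]addrC subrK.
  have wG' : w - c *: u1 \in G by rewrite rpredB ?rpredZ.
  by rewrite expand // lerDl; apply: B_ge0.
have := ler_wpM2l m_ge0 bx; rewrite mulrCA divfK ?gt_eqF // => mbx.
have c2 : 0 < c ^+ 2 by rewrite exprn_even_gt0.
have Bn : 0 <= c ^+ 2 * (`|B v1 v1| + B v1 v1).
  by rewrite mulr_ge0 ?sqr_ge0 // -lerBlDr sub0r -normrN ler_norm.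
apply: lt_le_trans (lerD mbx Bx); rewrite -mulrDr addrAC mulrDr mulr1.
exact: ltr_wpDl Bn c2.
Qed.

End RealForms.

(** * Functionals positive on a cone of squares *)

Section SquareCones.
Variables (E : vectType R) (D : nat) (B : E -> E -> 'rV[R]_D) (J : 'rV[R]_D -> Prop).
Hypothesis BP : symbilinear B.
Hypothesis J0 : J 0.
Hypothesis Jlin : forall a u v, J u -> J v -> J (a *: u + v).
Hypothesis Jpointed : forall l : seq E, J (\sum_(x <- l) B x x) ->
  forall x, x \in l -> forall y, J (B x y).

Let dot (t : 'I_D -> R) (u : 'rV[R]_D) : R^o := \sum_i u 0 i * t i.

Let dotP t a u v : dot t (a *: u + v) = a * dot t u + dot t v.
Proof.
rewrite /dot mulr_sumr -big_split; apply: eq_bigr => i _.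
by rewrite !mxE mulrDl mulrA.
Qed.

Let dotB t : symbilinear (fun x y => dot t (B x y)).
Proof.
by split=> [x y|a x y z]; [rewrite BP.1|rewrite BP.2 dotP].
Qed.

Let JD u v : J u -> J v -> J (u + v).
Proof. by move=> Ju; rewrite -[u]scale1r; exact: Jlin. Qed.

Let JZ a u : J u -> J (a *: u).
Proof. by move=> Ju; rewrite -[_ *: _]addr0; exact: Jlin. Qed.

Let JN u : J u -> J (- u).
Proof. by rewrite -scaleN1r; exact: JZ. Qed.

Let N x := forall y, J (B x y).

(* The sum e of the squares of a basis of F is an order unit of the cone of F, so the
   extension theorem applies with eta(e) = 1. *)
Lemma nonneg_functional (F : {vspace E}) (x0 : E) : x0 \in F -> ~ N x0 ->
  exists t, [/\ forall u, J u -> dot t u = 0,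
    forall x, x \in F -> 0 <= dot t (B x x) &
    exists2 x, x \in F & dot t (B x x) != 0].
Proof.
move=> x0F Nx0; pose e := \sum_(x <- vbasis F) B x x.
(* The cone is taken modulo J, so that a functional nonnegative on C vanishes on J. *)
pose C u := exists2 l : seq E, {subset l <= F} & J (u - \sum_(x <- l) B x x).
have CJ u : J u -> C u by exists [::] => //; rewrite big_nil subr0.
have CB x : x \in F -> C (B x x).
  exists [:: x]; first by move=> y; rewrite inE => /eqP ->.
  by rewrite big_seq1 subrr.
have CD u v : C u -> C v -> C (u + v).
  move=> [l lF lJ] [l' lF' lJ']; exists (l ++ l').
    by move=> x; rewrite mem_cat => /orP [/lF|/lF'].
  by rewrite big_cat /= opprD addrACA; exact: JD.
have CZ a u : 0 <= a -> C u -> C (a *: u).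
  move=> a_ge0 [l lF lJ]; exists [seq Num.sqrt a *: x | x <- l].
    by move=> _ /mapP [x /lF xF ->]; rewrite rpredZ.
  rewrite big_map (eq_bigr (fun x => a *: B x x)) => [|x _].
    by rewrite -scaler_sumr -scalerBr; exact: JZ.
  by rewrite !(symbilZl BP, symbilZr BP) scalerA -expr2 sqr_sqrtr.
have Csum (l : seq E) : {subset l <= F} -> C (\sum_(x <- l) B x x).
  by move=> lF; exists l => //; rewrite subrr.
have basF : {subset vbasis F <= F} by move=> x; exact: vbasis_mem.
have Ce : C e by exact: Csum.
pose dominated u := exists a, C (a *: e - u).
have domD u v : dominated u -> dominated v -> dominated (u + v).
  move=> [a Ca] [b Cb]; exists (a + b).
  by rewrite scalerDl opprD addrACA; exact: CD.
have domZ a u : 0 <= a -> dominated u -> dominated (a *: u).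
  move=> a_ge0 [b Cb]; exists (a * b).
  by rewrite -scalerA -scalerBr; exact: CZ.
(* Parallelogram law: B(x + y, x + y) + B(x - y, x - y) = 2 B(x, x) + 2 B(y, y). *)
have domBD x y : x \in F -> y \in F -> dominated (B x x) -> dominated (B y y) ->
    dominated (B (x + y) (x + y)).
  move=> xF yF dx dy; have [a Ca] := domD _ _ (domZ 2 _ (ler0n _ _) dx) (domZ 2 _ (ler0n _ _) dy).
  exists a; rewrite -[B (x + y) _](addrK (B (x - y) (x - y))) opprB addrCA.
  apply: CD; first by apply: CB; rewrite rpredB.
  congr (C (_ - _)) : Ca; rewrite -[- y]scaleN1r.
  rewrite !(symbilDl BP, symbilDr BP, symbilZl BP, symbilZr BP) (BP.1 y x).
  by apply/rowP => i; rewrite !mxE; ring.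
have domB x : x \in F -> dominated (B x x).
  move=> xF; rewrite (coord_vbasis xF).
  suff: (\sum_(i < \dim F) coord (vbasis F) i x *: (vbasis F)`_i) \in F /\
     dominated (B (\sum_(i < \dim F) coord (vbasis F) i x *: (vbasis F)`_i)
               (\sum_(i < \dim F) coord (vbasis F) i x *: (vbasis F)`_i)) by case.
  apply: (big_ind (fun z => z \in F /\ dominated (B z z))).
  - by rewrite mem0v symbil0l //; split=> //; exists 0; rewrite scale0r subrr; exact: CJ.
  - by move=> u v [uF du] [vF dv]; rewrite rpredD //; split=> //; exact: domBD.
  move=> i _; have iF : (vbasis F)`_i \in F by apply/basF/mem_nth; rewrite size_tuple.
  rewrite rpredZ //; split=> //; rewrite !(symbilZl BP, symbilZr BP) scalerA -expr2.
  apply: domZ; first exact: sqr_ge0.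
  (* Removing one term from e leaves the sum of the other squares. *)
  exists 1; rewrite scale1r /e (bigD1_seq (vbasis F)`_i) /=; last first.
  - exact/free_uniq/(basis_free (vbasisP F)).
  - by apply/mem_nth; rewrite size_tuple.
  rewrite addrAC subrr add0r -big_filter; apply: Csum => y.
  by rewrite mem_filter => /andP [_ /basF].
have domC u : C u -> dominated u.
  move=> [l lF lJ]; rewrite -[u](subrK (\sum_(x <- l) B x x)); apply: (domD).
    by exists 0; rewrite scale0r sub0r; apply/CJ/JN.
  rewrite big_seq; apply: (big_ind dominated) => [||x /lF /domB //].
    by exists 0; rewrite scale0r subrr; exact: CJ.
  exact: domD.
(* If - e were in C, then e plus a sum of squares would lie in J; by [Jpointed] every basis vector
   of F, hence [x0], would lie in N. *)
have Cne : ~ C (- e).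
  move=> [l lF]; rewrite -opprD -big_cat /= => /JN; rewrite opprK => Jl; apply: Nx0 => y.
  rewrite (coord_vbasis x0F) BP.1; apply: (big_ind (fun z => J (B y z))) => [|u v|i _].
  - by rewrite symbil0r.
  - by rewrite symbilDr //; exact: JD.
  rewrite symbilZr //; apply: JZ; rewrite BP.1; apply: Jpointed Jl _ _ _.
  by rewrite mem_cat mem_nth ?size_tuple.
have [t [t_ge0 te]] := riesz_extension CD CZ Ce domC Cne.
exists t; split=> [u Ju|x xF|]; last 1 first.
- have : dot t e != 0 by rewrite [dot t e]te oner_eq0.
  have [//|H] := pselect (exists2 x, x \in F & dot t (B x x) != 0).
  case/eqP; suff Hl (l : seq E) : {subset l <= F} -> dot t (\sum_(x <- l) B x x) = 0.
    exact: Hl.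
  elim: l => [|y l IHl] lF.
    by rewrite big_nil /dot big1 // => i _; rewrite mxE mul0r.
  rewrite big_cons -[B y y]scale1r dotP IHl ?addr0 ?mul1r => [|z zl]; last first.
    by apply: lF; rewrite in_cons zl orbT.
  by apply/eqP/negPn/negP => nz; apply: H; exists y => //; apply: lF; rewrite mem_head.
- apply/eqP; rewrite eq_le; apply/andP; split; last exact/t_ge0/CJ.
  have := t_ge0 _ (CJ _ (JN Ju)); rewrite -[X in 0 <= X]/(dot t (- u)).
  rewrite -[- u]addr0 -scaleN1r dotP mulN1r {2}/dot big1 ?addr0 ?oppr_ge0 //.
  by move=> i _; rewrite mxE mul0r.
- exact/t_ge0/CB.
Qed.

Theorem positive_functional (F : {vspace E}) :
  exists t : 'I_D -> R, (forall u, J u -> \sum_i u 0 i * t i = 0) /\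
    (forall x, x \in F -> ~ (forall y, J (B x y)) -> 0 < \sum_i B x x 0 i * t i).
Proof.
suff [t [tJ tF]] : exists t, (forall u, J u -> dot t u = 0) /\
    (forall x, x \in F -> ~ N x -> 0 < dot t (B x x)) by exists t.
have [n] := ubnP (\dim F); elim: n F => // n IHn F dimF.
have [[x0 x0F Nx0]|H] := pselect (exists2 x, x \in F & ~ N x); last first.
  exists (fun=> 0); split=> [u _|x xF Nx]; last by case: H; exists x.
  by rewrite /dot big1 // => i _; rewrite mulr0.
have [t0 [t0J t0F [x1 x1F tx1]]] := nonneg_functional x0F Nx0.
pose b0 x y := dot t0 (B x y); have b0P : symbilinear b0 := dotB t0.
(* F' is the radical of [b0] on F, a proper subspace since [b0] is not identically zero there. *)
have [F' F'P] : exists F' : {vspace E}, forall x, x \in F' <->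
    x \in F /\ forall y, y \in F -> b0 x y = 0.
  apply: vspace_of_pred => [y yF|a x y Px Py z zF]; first exact: symbil0l.
  by rewrite b0P.2 Px // Py // scaler0 addr0.
have sF' : (F' <= F)%VS by apply/subvP => x /F'P [].
have ker0 x : x \in F -> b0 x x = 0 -> x \in F'.
  move=> xF bx; apply/F'P; split=> // y yF; rewrite b0P.1.
  exact: (psd_radical b0P t0F).
have dimF' : (\dim F' < n)%N.
  rewrite -ltnS; apply: leq_trans dimF; rewrite ltnS ltn_neqAle dimvS // andbT.
  apply/negP => /eqP dimE; have /eqP FE : F' == F by rewrite eqEdim sF' dimE leqnn.
  by move: x1F tx1; rewrite -{1}FE => /F'P [x1F H]; rewrite -[dot _ _]/(b0 x1 x1) H ?eqxx.
have [t1 [t1J t1F']] := IHn F' dimF'.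
have [a aP] := @finsler _ b0 (fun x y => dot t1 (B x y)) F F' N b0P (dotB t1) sF' t0F ker0
   (fun x Nx y => conj (t0J _ (Nx y)) (t1J _ (Nx y))) t1F'.
have dotE u : dot (fun i => a * t0 i + t1 i) u = a * dot t0 u + dot t1 u.
  by rewrite /dot mulr_sumr -big_split; apply: eq_bigr => i _ /=; ring.
exists (fun i => a * t0 i + t1 i); split=> [u Ju|x xF Nx]; rewrite dotE.
  by rewrite t0J // t1J // mulr0 addr0.
exact: aP.
Qed.

End SquareCones.

End PositiveFunctionals.

(** * Quadratic modules, their supports and radicals *)

Section QuadraticModules.
Variables (K : numFieldType) (A : comAlgType K) (Q : A -> Prop).
Hypothesis Q1 : Q 1.
Hypothesis QD : forall x y, Q x -> Q y -> Q (x + y).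
Hypothesis QM : forall a x, Q x -> Q (a ^+ 2 * x).

Definition qsupp (x : A) := Q x /\ Q (- x).
Definition qradical (x : A) := exists N, qsupp (x ^+ N).

Lemma qmod_sqr a : Q (a ^+ 2).
Proof. by rewrite -[_ ^+ 2]mulr1; exact: QM. Qed.

Lemma qmod0 : Q 0.
Proof. by have := qmod_sqr 0; rewrite expr0n. Qed.

Lemma qsupp0 : qsupp 0.
Proof. by split; rewrite ?oppr0; exact: qmod0. Qed.

Lemma qsuppD x y : qsupp x -> qsupp y -> qsupp (x + y).
Proof. by move=> [Qx Qnx] [Qy Qny]; split; rewrite ?opprD; exact: QD. Qed.

(** Every a is a difference of two squares, ((a + 1) / 2)^2 - ((a - 1) / 2)^2, and Q absorbs
    squares. *)
Lemma qsuppMl a x : qsupp x -> qsupp (a * x).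
Proof.
move=> [Qx Qnx]; pose h : A := 2^-1%:A.
have hh : h + h = 1 by rewrite -scalerDl -mulr2n -(mulr_natr 2^-1) mulVf ?scale1r // pnatr_eq0.
have aE : a = (h * (a + 1)) ^+ 2 - (h * (a - 1)) ^+ 2.
  have -> : (h * (a + 1)) ^+ 2 - (h * (a - 1)) ^+ 2 = (h + h) ^+ 2 * a by ring.
  by rewrite hh expr1n mul1r.
rewrite {1}aE; split; rewrite ?opprD mulrBl.
  by rewrite -mulrN; apply: QD; exact: QM.
by rewrite opprB addrC -mulrN; apply: QD; exact: QM.
Qed.

(** - x is the sum of y and - (x + y), both in Q. *)
Lemma qsupp_summand x y : Q x -> Q y -> qsupp (x + y) -> qsupp x.
Proof.
move=> Qx Qy [_ Qn]; split=> //; rewrite -(subrK y (- x)) -opprD.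
exact: QD.
Qed.

Lemma qradical0 : qradical 0.
Proof. by exists 1%N; rewrite expr1; exact: qsupp0. Qed.

Lemma qradicalMl a x : qradical x -> qradical (a * x).
Proof. by move=> [N xN]; exists N; rewrite exprMn; exact: qsuppMl. Qed.

Lemma qradicalD x y : qradical x -> qradical y -> qradical (x + y).
Proof.
move=> [N xN] [M yM]; exists (N + M)%N; rewrite exprDn.
apply: (big_ind qsupp) => [||i _]; [exact: qsupp0|exact: qsuppD|].
rewrite -mulr_natl; apply: qsuppMl; have [iM|Mi] := leqP i M.
  by rewrite -addnBA // exprD -mulrA mulrC; exact: qsuppMl.
have -> : y ^+ i = y ^+ (i - M) * y ^+ M by rewrite -exprD subnK // ltnW.
by rewrite mulrA; exact: qsuppMl.
Qed.

Lemma qradical_sum (I : Type) (r : seq I) (P : pred I) (F : I -> A) :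
  (forall i, P i -> qradical (F i)) -> qradical (\sum_(i <- r | P i) F i).
Proof. by move=> FP; apply: big_ind; [exact: qradical0|exact: qradicalD|]. Qed.

Lemma qradicalX N x : qradical (x ^+ N) -> qradical x.
Proof. by move=> [M xM]; exists (N * M)%N; rewrite exprM. Qed.

(* With j = x + y, every term of x ^+ m * j ^+ 2 = x ^+ m * (x ^+ 2 + 2 x y + y ^+ 2)
   lies in Q as soon as m is odd, so the exponent of j can be lowered by two. *)
Lemma qradical_summand x y : Q x -> Q y -> qradical (x + y) -> qradical x.
Proof.
move=> Qx Qy [N]; set j := x + y => jN.
suff H c m : qsupp (x ^+ m * j ^+ (2 * c)) -> qradical x.
  by apply: (H N 0%N); rewrite mul2n -addnn exprD mul1r; exact: qsuppMl.
elim: c m => [m|c IHc m xm]; first by rewrite muln0 mulr1; exists m.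
apply: (IHc (2 * m + 3)%N).
(* The factor [x ^+ m.+1] makes the exponent of x odd; the first term of the expansion is the one
   wanted. *)
have := qsuppMl (x ^+ m.+1) xm.
have -> : x ^+ m.+1 * (x ^+ m * j ^+ (2 * c.+1)) = x ^+ (2 * m + 3) * j ^+ (2 * c) +
    ((x ^+ m.+1 * j ^+ c) ^+ 2 * y + ((x ^+ m.+1 * j ^+ c) ^+ 2 * y
      + (x ^+ m * j ^+ c * y) ^+ 2 * x)).
  have -> : (2 * m + 3 = m + m + 3)%N by lia.
  have -> : (2 * c.+1 = c + c + 2)%N by lia.
  rewrite mul2n -addnn !exprD exprS /j; move: (x ^+ m) ((x + y) ^+ c) => X Y.
  by ring.
apply: qsupp_summand; last by do !apply: QD; exact: QM.
rewrite (_ : x ^+ _ * _ = (x ^+ m.+1 * j ^+ c) ^+ 2 * x); first exact: QM.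
by rewrite exprMn -!exprM mulrAC -exprSr; congr (_ ^+ _ * _ ^+ _); lia.
Qed.

End QuadraticModules.

(** * Dickson's lemma and Hilbert's basis theorem *)

Section HilbertBasis.

(** Each index is chosen where u is minimal on the tail beyond the previous index. *)
Lemma nondecreasing_subseq (u : nat -> nat) :
  exists f : nat -> nat, (forall i j, (i < j)%N -> (f i < f j)%N) /\
                         (forall i j, (i <= j)%N -> (u (f i) <= u (f j))%N).
Proof.
have minP k : exists i, (k <= i)%N /\ forall j, (k <= j)%N -> (u i <= u j)%N.
  have exQ : exists v, `[< exists2 i, (k <= i)%N & u i = v >].
    by exists (u k); apply/asboolP; exists k.
  case: (ex_minnP exQ) => _ /asboolP [i ki <-] min_i; exists i; split=> // j kj.
  by apply: min_i; apply/asboolP; exists j.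
have [h hP] := choice minP; pose f i := iter i (fun x => h x.+1) (h 0%N).
have f_mono i : (f i < f i.+1)%N by exact: (hP (f i).+1).1.
have f_ltn : forall i j, (i < j)%N -> (f i < f j)%N by exact: homo_ltn ltn_trans f_mono.
exists f; split=> // i j; rewrite leq_eqVlt => /orP [/eqP -> //|ij].
case: i ij => [|i] ij; first exact: (hP 0%N).2.
by apply: (hP (f i).+1).2; apply: ltn_trans (f_mono i) (f_ltn _ _ ij).
Qed.

Variable n : nat.

(** A subsequence is refined once per variable, until every exponent is nondecreasing along it. *)
Lemma dickson (u : nat -> 'X_{1..n}) : exists i j, (i < j)%N /\ (u i <= u j)%MM.
Proof.
suff H (l : seq 'I_n) : exists f : nat -> nat, (forall i j, (i < j)%N -> (f i < f j)%N) /\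
    (forall a i j, a \in l -> (i <= j)%N -> (u (f i) a <= u (f j) a)%N).
  have [f [f_ltn fP]] := H (enum 'I_n); exists (f 0%N), (f 1%N); split; first exact: f_ltn.
  by apply/mnm_lepP => a; apply: fP; rewrite ?mem_enum.
elim: l => [|a l [f [f_ltn fP]]]; first by exists id.
have [h [h_ltn hP]] := nondecreasing_subseq (fun i => u (f i) a).
exists (f \o h); split=> [i j ij|b i j]; first exact/f_ltn/h_ltn.
rewrite in_cons => /orP [/eqP -> /hP //|bl ij]; apply: fP => //.
by move: ij; rewrite leq_eqVlt => /orP [/eqP ->|/h_ltn/ltnW].
Qed.

(** If no finite list worked, choice would build a sequence in P where no monomial is divisible by
    an earlier one, against Dickson's lemma. *)
Lemma finite_minimal_monomials (T : eqType) (P : T -> Prop) (h : T -> 'X_{1..n}) :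
  exists l : seq T, (forall x, x \in l -> P x) /\
    forall x, P x -> exists2 y, y \in l & (h y <= h x)%MM.
Proof.
apply: contrapT => nl.
have pickP (l : {l : seq T | forall x, x \in l -> P x}) :
    exists x, P x /\ forall y, y \in sval l -> ~~ (h y <= h x)%MM.
  apply: contrapT => nx; apply: nl; exists (sval l); split; first exact: (svalP l).
  move=> x Px; apply: contrapT => ny; apply: nx; exists x; split=> // y yl.
  by apply/negP => hyx; apply: ny; exists y.
have [p pP] := choice pickP.
have consP (l : {l : seq T | forall x, x \in l -> P x}) x :
    x \in p l :: sval l -> P x.
  by rewrite in_cons => /orP [/eqP ->|/(svalP l) //]; exact: (pP l).1.
pose next l : {l : seq T | forall x, x \in l -> P x} := exist _ _ (consP l).
have nilP x : x \in [::] -> P x by [].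
pose L i := iter i next (exist _ _ nilP).
have memL i j : (i < j)%N -> p (L i) \in sval (L j).
  elim: j => // j IHj; rewrite ltnS leq_eqVlt => /orP [/eqP ->|/IHj H].
    exact: mem_head.
  by rewrite in_cons H orbT.
have [i [j [ij hij]]] := dickson (fun i => h (p (L i))).
by move: ((pP (L j)).2 _ (memL _ _ ij)); rewrite hij.
Qed.

(** The list l is a Gröbner basis of I: division by it lowers the leading monomial of f, and the
    monomial order is well founded. *)
Theorem hilbert_basis (K : fieldType) (I : {mpoly K[n]} -> Prop) :
  I 0 -> (forall p q, I p -> I q -> I (p + q)) -> (forall a p, I p -> I (a * p)) ->
  exists l : seq {mpoly K[n]}, (forall p, p \in l -> I p) /\
    forall f, I f -> exists c : seq ({mpoly K[n]} * {mpoly K[n]}),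
      (forall x, x \in c -> x.2 \in l) /\ f = \sum_(x <- c) x.1 * x.2.
Proof.
move=> I0 ID IM.
have [l [lI lP]] := finite_minimal_monomials (fun p => I p /\ p != 0) (@mlead n K).
exists l; split=> [p /lI []//|f].
move: (erefl (mlead f)); move: {1}(mlead f) => m; elim/(well_founded_ind (@ltom_wf n)): m f.
move=> m IHm f fm If; have [->|f0] := eqVneq f 0; first by exists [::]; rewrite big_nil.
have [y yl yf] := lP f (conj If f0); have [Iy y0] := lI y yl.
set d := (mlead f - mlead y)%MM; have dE : (d + mlead y)%MM = mlead f by rewrite submK.
(* This multiple of y has the same leading term as f. *)
pose a : {mpoly K[n]} := (mleadc f / mleadc y) *: 'X_[d].
have ay : (a * y)@_(mlead f) = mleadc f.
  have Xy : ('X_[d] * y)@_(mlead f) = mleadc y by rewrite mulrC -dE mcoeffMX.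
  by rewrite -scalerAl mcoeffZ Xy divfK // mleadc_eq0.
have If' : I (f - a * y) by apply: ID => //; rewrite -mulNr; exact: IM.
suff [c [cl cE]] : exists c : seq ({mpoly K[n]} * {mpoly K[n]}),
    (forall x, x \in c -> x.2 \in l) /\ f - a * y = \sum_(x <- c) x.1 * x.2.
  exists ((a, y) :: c); split=> [x|].
    by rewrite in_cons => /orP [/eqP ->|/cl].
  by rewrite big_cons -cE addrC subrK.
have [->|f'0] := eqVneq (f - a * y) 0; first by exists [::]; rewrite big_nil.
apply: IHm (erefl _) If'; rewrite fm lt_neqAle; apply/andP; split.
  apply: contraNneq f'0 => H.
  by rewrite -mleadc_eq0 H mcoeffB ay subrr.
apply: le_trans (mleadB_le _ _) _; rewrite leUx lexx /=.
apply: le_trans (mleadM_le _ _) _; rewrite -dE lem_leo //.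
have -> : mlead a = d; last exact: lepm_refl.
by rewrite mleadZ ?mleadXm // mulf_neq0 ?invr_eq0 ?mleadc_eq0.
Qed.

End HilbertBasis.

(** * Degrees and sums of squares of polynomials *)

Section Polynomials.
Variable n : nat.
Implicit Types (p q f : {mpoly R[n]}).

Lemma degleW a b p : (a <= b)%N -> degle a p -> degle b p.
Proof. by move=> ab pa; apply: leq_trans pa _; rewrite ltnS. Qed.

Lemma degle_tdeg a p : degle a p <-> (tdeg p <= a)%N.
Proof. by rewrite /degle /tdeg; lia. Qed.

Lemma degle0 a : degle a (0 : {mpoly R[n]}).
Proof. by rewrite /degle msize0. Qed.

Lemma degle1 a : degle a (1 : {mpoly R[n]}).
Proof. by rewrite /degle msize1. Qed.

Lemma degleD a p q : degle a p -> degle a q -> degle a (p + q).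
Proof. by move=> pa qa; apply: leq_trans (msizeD_le p q) _; rewrite geq_max; apply/andP. Qed.

Lemma degleZ a c p : degle a p -> degle a (c *: p).
Proof. by move=> pa; apply: leq_trans (msizeZ_le p c) _. Qed.

Lemma degleM a b p q : degle a p -> degle b q -> degle (a + b) (p * q).
Proof.
have [->|p0] := eqVneq p 0; first by rewrite mul0r => _ _; exact: degle0.
have [->|q0] := eqVneq q 0; first by rewrite mulr0 => _ _; exact: degle0.
rewrite /degle msizeM //; move: (msize p) (msize q) => i j. lia.
Qed.

Lemma degleX a N p : degle a p -> degle (N * a) (p ^+ N).
Proof.
move=> pa; elim: N => [|N IHN]; first by rewrite expr0; exact: degle1.
by rewrite exprS mulSn; exact: degleM.
Qed.

Lemma degle_sum a (I : Type) (r : seq I) (P : pred I) (F : I -> {mpoly R[n]}) :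
  (forall i, P i -> degle a (F i)) -> degle a (\sum_(i <- r | P i) F i).
Proof. by move=> FP; apply: big_ind; [exact: degle0|move=> x y; exact: degleD|]. Qed.

Lemma sos_sqr q : sos (q ^+ 2).
Proof. by exists [:: q]; rewrite big_seq1. Qed.

Lemma sos0 : sos (0 : {mpoly R[n]}).
Proof. by exists [::]; rewrite big_nil. Qed.

Lemma sos1 : sos (1 : {mpoly R[n]}).
Proof. by rewrite -(expr1n _ 2); exact: sos_sqr. Qed.

Lemma sosD p q : sos p -> sos q -> sos (p + q).
Proof. by move=> [l ->] [l' ->]; exists (l ++ l'); rewrite big_cat. Qed.

Lemma sosM_sqr a p : sos p -> sos (a ^+ 2 * p).
Proof.
move=> [l ->]; exists [seq a * q | q <- l]; rewrite big_map mulr_sumr.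
by apply: eq_bigr => q _; rewrite exprMn.
Qed.

(* The squares of the leading coefficients of maximal degree cannot cancel. *)
Lemma tdeg_sos (l : seq {mpoly R[n]}) q :
  q \in l -> (2 * tdeg q <= tdeg (\sum_(r <- l) r ^+ 2))%N.
Proof.
move=> ql; have [q1 [q1l q1max]] : exists q1, q1 \in l /\
    forall r, r \in l -> (mlead r <= mlead q1)%O.
  elim: l {ql} q ql => // r [|r' l] IHl q _.
    by exists r; rewrite mem_head; split=> // x; rewrite inE => /eqP ->.
  have [q1 [q1l q1max]] := IHl r' (mem_head _ _).
  have [H|H] := leP (mlead r) (mlead q1).
    exists q1; rewrite in_cons q1l orbT; split=> // x.
    by rewrite in_cons => /orP [/eqP -> //|]; exact: q1max.
  exists r; rewrite mem_head; split=> // x.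
  rewrite in_cons => /orP [/eqP -> //|xl].
  exact: le_trans (q1max _ xl) (ltW H).
have tdegE r : tdeg r = mdeg (mlead r).
  (* For r = 0 both sides are 0 by convention. *)
  rewrite /tdeg; have [->|r0] := eqVneq r 0; first by rewrite msize0 mlead0 mdeg0.
  by rewrite -mlead_deg.
have qdeg : (tdeg q <= mdeg (mlead q1))%N by rewrite tdegE; exact: lemc_mdeg (q1max _ ql).
have [q10|q10] := eqVneq q1 0.
  by move: qdeg; rewrite q10 mlead0 mdeg0 leqn0 => /eqP ->.
set m := mlead q1 in q1max qdeg.
(* No leading monomial exceeds m, so a square reaches [m + m] only as m times m. *)
have H : (\sum_(r <- l) r ^+ 2)@_(m + m) = \sum_(r <- l) r@_m ^+ 2.
  rewrite raddf_sum !big_seq; apply: eq_bigr => r rl /=.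
  by rewrite !expr2 mleadcMW // q1max.
have : (m + m)%MM \in msupp (\sum_(r <- l) r ^+ 2).
  rewrite mcoeff_msupp H psumr_neq0 => [|r _]; last exact: sqr_ge0.
  by apply/hasP; exists q1 => //=; rewrite exprn_even_gt0 //= mleadc_eq0.
move/msize_mdeg_lt; rewrite mdegD /tdeg; move: qdeg; rewrite /tdeg; lia.
Qed.

(** * Truncated quadratic modules and Hankel kernels *)

Section Moments.
Variables (s : nat) (g : 'I_s -> {mpoly R[n]}).

Lemma QtW a b q : (a <= b)%N -> Qt g a q -> Qt g b q.
Proof.
move=> ab [s0 [sg [[s0s s0a] sgP ->]]]; exists s0, sg; split=> //.
  by split=> //; exact: degleW s0a.
by move=> i; have [? [|H]] := sgP i; split=> //; [left|right; exact: leq_trans ab].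
Qed.

Lemma Qt_sqr a q : degle a q -> Qt g (2 * a) (q ^+ 2).
Proof.
move=> qa; exists (q ^+ 2), (fun=> 0); split.
- by split; [exact: sos_sqr|exact: degleX].
- by move=> i; split; [exact: sos0|left].
- by rewrite big1 ?addr0 // => i _; rewrite mul0r.
Qed.

(** In the union over t the degree bounds disappear: any representation satisfies them for t
    large. *)
Lemma QME q : QM g q <-> exists s0 sg,
  [/\ sos s0, forall i, sos (sg i) & q = s0 + \sum_(i < s) sg i * g i].
Proof.
split=> [[t [s0 [sg [[s0s _] sgP ->]]]]|[s0 [sg [s0s sgs ->]]]].
  by exists s0, sg; split=> // i; exact: (sgP i).1.
exists (maxn (tdeg s0) (\max_(i < s) (tdeg (sg i) + tdeg (g i)))); exists s0, sg; split=> //.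
  by split=> //; apply/degle_tdeg; exact: leq_maxl.
move=> i; split=> //; right; apply: leq_trans (leq_maxr _ _).
exact: (leq_bigmax i).
Qed.

Lemma QM_sos q : sos q -> QM g q.
Proof.
move=> qs; apply/QME; exists q, (fun=> 0); split=> // [i|]; first exact: sos0.
by rewrite big1 ?addr0 // => i _; rewrite mul0r.
Qed.

Lemma QM_gen i : QM g (g i).
Proof.
apply/QME; exists 0, (fun j => (j == i)%:R); split=> [|j|]; first exact: sos0.
  by case: (j == i); [exact: sos1|exact: sos0].
rewrite add0r (bigD1 i) //= eqxx mul1r big1 ?addr0 // => j /negPf ->.
by rewrite mul0r.
Qed.

Lemma QM1 : QM g 1.
Proof. exact/QM_sos/sos1. Qed.

Lemma QMD p q : QM g p -> QM g q -> QM g (p + q).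
Proof.
move=> /QME [s0 [sg [s0s sgs ->]]] /QME [t0 [tg [t0s tgs ->]]]; apply/QME.
exists (s0 + t0), (fun i => sg i + tg i); split=> [|i|]; [exact: sosD|exact: sosD|].
rewrite addrACA -big_split; congr (_ + _); apply: eq_bigr => i _.
by rewrite mulrDl.
Qed.

Lemma QMM a p : QM g p -> QM g (a ^+ 2 * p).
Proof.
move=> /QME [s0 [sg [s0s sgs ->]]]; apply/QME.
exists (a ^+ 2 * s0), (fun i => a ^+ 2 * sg i); split=> [|i|]; [exact: sosM_sqr|exact: sosM_sqr|].
by rewrite mulrDr mulr_sumr; congr (_ + _); apply: eq_bigr => i _; rewrite mulrA.
Qed.

(* The real radical of supp Q is the usual one: f^(2m) + s in -Q forces f^(2m) in -Q. *)
Lemma real_radicalE f : real_radical (suppQ g) f <-> qradical (QM g) f.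
Proof.
split=> [[m [sq [sqs fI]]]|[N fN]].
  exists (2 * m)%N; apply: (qsupp_summand QMD) fI; last exact: QM_sos.
  by rewrite mulnC exprM; apply/QM_sos/sos_sqr.
exists N, 0; split; first exact: sos0.
by rewrite addr0 mul2n -addnn exprD; exact: qsuppMl QMD QMM _ _ fN.
Qed.

(** Cauchy-Schwarz for the form sigma(p q), all products staying in degree at most 2 k. *)
Lemma Lt_kerH k sigma p : Lt g (2 * k) sigma -> degle k p -> sigma (p ^+ 2) = 0 ->
  kerH k sigma p.
Proof.
move=> [lin_s pos_s] pk p2; split=> // q qk; apply/eqP/negPn/negP => nz.
have k2 : (2 * k = k + k)%N by rewrite mul2n addnn.
have pqk : degle (2 * k) (p * q) by rewrite k2; exact: degleM.
have ppk : degle (2 * k) (p ^+ 2) by exact: degleX.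
have qqk : degle (2 * k) (q ^+ 2) by exact: degleX.
(* With this c, sigma would be -1 at the square of [c *: p + q]. *)
pose c := - (sigma (q ^+ 2) + 1) / (2 * sigma (p * q)).
have := pos_s _ (Qt_sqr (degleD (degleZ c pk) qk)).
have -> : (c *: p + q) ^+ 2 = c ^+ 2 *: p ^+ 2 + ((2 * c) *: (p * q) + q ^+ 2).
  by rewrite sqrrD exprZn -scalerAl -scaler_nat scalerA addrA.
rewrite lin_s ?p2 ?mulr0 ?add0r //; last by apply: degleD => //; exact: degleZ.
rewrite lin_s // (_ : 2 * c * _ + _ = - 1) ?oppr_ge0 ?ler10 //.
by rewrite /c; field.
Qed.

(** Descent on b: a power whose square is killed lies in the kernel, and pairing it with 1 kills the
    square of the preceding power. *)
Lemma Lt_sqr_eq0 k sigma p b : Lt g (2 * k) sigma ->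
  (forall c, (c <= b)%N -> degle k (p ^+ (expn 2 c))) ->
  sigma ((p ^+ (expn 2 b)) ^+ 2) = 0 -> sigma (p ^+ 2) = 0.
Proof.
move=> Ls; elim: b => [|b IHb] pc p0; first by rewrite -{1}(expr1 p).
have [_ H] := Lt_kerH Ls (pc _ (leqnn _)) p0; apply: IHb.
  by move=> c cb; apply: pc; exact: leqW.
by move: (H 1 (degle1 k)); rewrite mulr1 expnSr exprM.
Qed.

Lemma radical_in_kernel f : qradical (QM g) f ->
  exists k0, forall k, (k0 <= k)%N -> forall sigma, Lt g (2 * k) sigma ->
    sigma (f ^+ 2) = 0.
Proof.
move=> [N fN]; pose h := f ^+ (expn 2 N) ^+ 2.
have [_ [T hT]] : qsupp (QM g) h.
  have N2 : (N <= expn 2 N * 2)%N by apply: leq_trans (ltnW (ltn_expl N (leqnn 2))) (leq_pmulr _ _).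
  by rewrite /h -exprM -(subnK N2) exprD; exact: qsuppMl QMD QMM _ _ fN.
(* T is a level at which [- h] has a representation; the other bound keeps the powers of f in the
   descent in degree at most k. *)
exists (maxn T (expn 2 N * tdeg f))%N => k; rewrite geq_max => /andP [Tk fk] sigma Ls.
have fc c : (c <= N)%N -> degle k (f ^+ (expn 2 c)).
  move=> cN; apply: (@degleW (expn 2 c * tdeg f)).
    by apply: leq_trans fk; rewrite leq_mul2r leq_pexp2l ?orbT.
  by apply: degleX; apply/degle_tdeg.
apply: (Lt_sqr_eq0 (b := N) Ls) => //.
have [lin_s pos_s] := Ls.
have Tk2 : (T <= 2 * k)%N by lia.
have hk : degle (2 * k) h by rewrite /h; apply: degleX; exact: fc.
have s0 : sigma 0 = 0.
  have := lin_s 1 0 0 (degle0 _) (degle0 _); rewrite scale1r mul1r addr0 => H.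
  by apply: (addrI (sigma 0)); rewrite addr0 -H.
have sN : sigma (- h) = - sigma h.
  by have := lin_s (- 1) h 0 hk (degle0 _); rewrite s0 !addr0 scaleN1r mulN1r.
apply/eqP; rewrite eq_le; apply/andP; split.
  by rewrite -oppr_ge0 -sN; apply/pos_s/(QtW Tk2).
by apply/pos_s/Qt_sqr; exact: fc.
Qed.


(* A point x of E encodes a tuple of polynomials q_o, one for each o in [option 'I_s]
   ([None] standing for the constant weight 1), with deg (q_o^2 * g_o) <= 2 * k; the
   coefficients of x at monomials of larger degree are ignored. *)
Section Separation.
Variable k : nat.

Let gen (o : option 'I_s) : {mpoly R[n]} := if o is Some i then g i else 1.
Let E : vectType R := {ffun (option 'I_s * 'X_{1..n < k.+1}) -> R^o}.
Let D := #|{: 'X_{1..n < (2 * k).+1}}|.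
Let mono (j : 'I_D) : 'X_{1..n < (2 * k).+1} := enum_val j.

Let pol (o : option 'I_s) (x : E) : {mpoly R[n]} :=
  \sum_(m : 'X_{1..n < k.+1} | (2 * mdeg m + tdeg (gen o) <= 2 * k)%N) x (o, m) *: 'X_[m].
(** The sums of values [form x x] are exactly the elements of the truncated quadratic module of
    level 2 k. *)
Let form (x y : E) := \sum_o pol o x * pol o y * gen o.
Let coords p : 'rV[R]_D := \row_j p@_(mono j).
Let ofcoords (c : 'rV[R]_D) : {mpoly R[n]} := \sum_j c 0 j *: 'X_[mono j].

Let pol_lin o a x y : pol o (a *: x + y) = a *: pol o x + pol o y.
Proof.
rewrite scaler_sumr -big_split; apply: eq_bigr => m _ /=.
by rewrite !ffunE scalerDl scalerA.
Qed.

Let coords_lin a p q : coords (a *: p + q) = a *: coords p + coords q.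
Proof. by apply/rowP => j; rewrite !mxE mcoeffD mcoeffZ. Qed.

Let coords0 : coords 0 = 0.
Proof. by apply/rowP => j; rewrite !mxE mcoeff0. Qed.

Let ofcoords_lin a u v : ofcoords (a *: u + v) = a *: ofcoords u + ofcoords v.
Proof.
rewrite scaler_sumr -big_split; apply: eq_bigr => j _ /=.
by rewrite !mxE scalerDl scalerA.
Qed.

Let ofcoords0 : ofcoords 0 = 0.
Proof. by rewrite /ofcoords big1 // => j _; rewrite mxE scale0r. Qed.

Let coordsK p : degle (2 * k) p -> ofcoords (coords p) = p.
Proof.
move=> pk; rewrite [RHS](mpolywE pk).
rewrite (reindex mono) /=; last first.
  by exists enum_rank => x _; [exact: enum_valK|exact: enum_rankK].
by apply: eq_big => j; [|rewrite mxE].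
Qed.

Let form_deg x y : degle (2 * k) (form x y).
Proof.
apply: degle_sum => o _; rewrite -mulrA mulr_suml; apply: degle_sum => m mP.
rewrite mulr_suml mulr_sumr; apply: degle_sum => m' mP'.
apply: (@degleW (mdeg m + (mdeg m' + tdeg (gen o)))); first by lia.
have Xdeg (d : 'X_{1..n}) c : degle (mdeg d) (c *: 'X_[d]).
  by apply: degleZ; rewrite /degle msizeX.
by do !apply: degleM => //; exact/degle_tdeg.
Qed.

Let form_sym : symbilinear (fun x y => coords (form x y)).
Proof.
split=> [x y|a x y z].
  by congr coords; apply: eq_bigr => o _; rewrite (mulrC (pol o x)).
rewrite -coords_lin; congr coords; rewrite scaler_sumr -big_split.
apply: eq_bigr => o _ /=; rewrite pol_lin !mulrDl.
by rewrite !scalerAl.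
Qed.

Let gen_QM o : QM g (gen o).
Proof. by case: o => [i|]; [exact: QM_gen|exact: QM1]. Qed.

Let J p := qradical (QM g) p.
Let J0 : J 0 := qradical0 QM1 QMM.
Let JD p q : J p -> J q -> J (p + q) := @qradicalD _ _ _ QM1 QMD QMM p q.
Let JM a p : J p -> J (a * p) := @qradicalMl _ _ _ QMD QMM a p.
Let JZ a p : J p -> J (a *: p).
Proof. by rewrite -mul_mpolyC; exact: JM. Qed.

(** By convexity of J each q_o^2 g_o lies in J. Multiplied by g_o it becomes the square of q_o g_o,
    which then lies in J because J is radical. *)
Let form_pointed (l : seq E) : J (\sum_(x <- l) form x x) ->
  forall x, x \in l -> forall y, J (form x y).
Proof.
have QMsum (I : Type) (r : seq I) (F : I -> {mpoly R[n]}) :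
    (forall i, QM g (F i)) -> QM g (\sum_(i <- r) F i).
  by move=> FP; apply: big_ind => //; [exact/QM_sos/sos0|exact: QMD].
have Qpol x o : QM g (pol o x * pol o x * gen o) by rewrite -expr2; exact: QMM.
have Qform x : QM g (form x x) by exact: QMsum.
move=> Jl x xl y; apply: (qradical_sum QM1 QMD QMM) => o _.
have : J (form x x).
  rewrite (big_rem x xl) /= in Jl; apply: (qradical_summand QMD QMM) Jl => //.
  exact: QMsum.
rewrite /form (bigD1 o) //= => /(qradical_summand QMD QMM (Qpol x o)) Jo.
have {}Jo : J (pol o x * pol o x * gen o).
  by apply: Jo; rewrite big_mkcond; apply: QMsum => i; case: ifP => // _; exact/QM_sos/sos0.
have : J ((pol o x * gen o) ^+ 2).
  by rewrite (_ : _ ^+ 2 = gen o * (pol o x * pol o x * gen o)); [exact: JM|ring].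
move=> /qradicalX Jpg; rewrite (_ : _ * _ = pol o y * (pol o x * gen o)); last by ring.
exact: JM.
Qed.

Let pol_surj o q : (2 * tdeg q + tdeg (gen o) <= 2 * k)%N ->
  exists x : E, forall o', pol o' x = if o' == o then q else 0.
Proof.
move=> qk; exists [ffun om : option 'I_s * 'X_{1..n < k.+1} => if om.1 == o then q@_(om.2) else 0] => o'.
have [->|neq] := eqVneq o' o; last first.
  by rewrite /pol big1 // => m _; rewrite ffunE /= (negPf neq) scale0r.
have qk' : (msize q <= k.+1)%N by apply/degle_tdeg; lia.
rewrite [RHS](mpolywE qk') /pol big_mkcond; apply: eq_bigr => m _ /=.
rewrite ffunE /= eqxx; case: ifPn => // mk.
(* The monomials dropped by [pol] have degree greater than that of q. *)
rewrite memN_msupp_eq0 ?scale0r //; apply: msize_mdeg_ge.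
by move: mk qk; rewrite /tdeg; move: (msize q); lia.
Qed.

Let form_surj o q : (2 * tdeg q + tdeg (gen o) <= 2 * k)%N ->
  exists2 x : E, form x x = q ^+ 2 * gen o & pol o x = q.
Proof.
move=> /pol_surj [x xP]; exists x; last by rewrite xP eqxx.
rewrite /form (bigD1 o) //= xP eqxx big1 ?addr0 // => o' /negPf neq.
by rewrite xP neq !mul0r.
Qed.

Theorem truncated_functional : exists eta, Lt g (2 * k) eta /\
  forall p, degle k p -> eta (p * p) = 0 -> J p.
Proof.
have Jlin a (u v : 'rV[R]_D) : J (ofcoords u) -> J (ofcoords v) -> J (ofcoords (a *: u + v)).
  by move=> Ju Jv; rewrite ofcoords_lin; apply: JD => //; exact: JZ.
have pointed (l : seq E) : J (ofcoords (\sum_(x <- l) coords (form x x))) ->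
    forall x, x \in l -> forall y, J (ofcoords (coords (form x y))).
  have -> : ofcoords (\sum_(x <- l) coords (form x x)) = \sum_(x <- l) form x x.
    elim: l => [|x l IHl]; first by rewrite !big_nil.
    rewrite !big_cons -[coords (form x x)]scale1r ofcoords_lin scale1r coordsK // IHl.
    by [].
  by move=> Jl x xl y; rewrite coordsK //; exact: (form_pointed Jl).
have J0' : J (ofcoords 0) by rewrite ofcoords0.
have [t [tJ tpos]] := positive_functional form_sym J0' Jlin pointed fullv.
pose eta p := \sum_i coords p 0 i * t i.
have eta_lin a p q : eta (a *: p + q) = a * eta p + eta q.
  rewrite /eta mulr_sumr -big_split; apply: eq_bigr => i _ /=.
  by rewrite coords_lin !mxE mulrDl mulrA.
have eta0 : eta 0 = 0 by rewrite /eta coords0 big1 // => i _; rewrite mxE mul0r.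
have etaD p q : eta (p + q) = eta p + eta q by rewrite -{1}[p]scale1r eta_lin mul1r.
have eta_form x : 0 <= eta (form x x).
  have [Jx|nJx] := pselect (forall y, J (ofcoords (coords (form x y)))).
    by rewrite /eta tJ.
  exact/ltW/(tpos x (memvf x) nJx).
(* By [tdeg_sos] each single square respects the degree bound of the sum, so it comes from a point
   of E. *)
have eta_sos o q : sos q -> (tdeg q + tdeg (gen o) <= 2 * k)%N -> 0 <= eta (q * gen o).
  move=> [l ->] lk; rewrite mulr_suml big_seq.
  apply: (big_ind (fun z => 0 <= eta z)) => [|p r|r rl]; first by rewrite eta0.
    by rewrite etaD; exact: addr_ge0.
  have rk : (2 * tdeg r + tdeg (gen o) <= 2 * k)%N.
    by apply: leq_trans lk; rewrite leq_add2r; exact: tdeg_sos rl.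
  by have [x <- _] := form_surj rk.
exists eta; split.
  split=> [a p q _ _|_ [s0 [sg [[s0s s0k] sgP ->]]]]; first exact: eta_lin.
  rewrite etaD; apply: addr_ge0.
    by rewrite -[s0]mulr1; apply: (eta_sos None) => //; rewrite /tdeg msize1 addn0; exact/degle_tdeg.
  apply: (big_ind (fun z => 0 <= eta z)) => [|p r|i _]; first by rewrite eta0.
    by rewrite etaD; exact: addr_ge0.
  have [sgs [sg0|sgk]] := sgP i; first by rewrite sg0 mul0r eta0.
  exact: (eta_sos (Some i)).
move=> p pk etap; apply: contrapT => nJp.
have pk' : (2 * tdeg p + tdeg (gen None) <= 2 * k)%N.
  by rewrite /= {2}/tdeg msize1 addn0 leq_mul2l /=; exact/degle_tdeg.
have [x xx px] := form_surj pk'.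
suff : 0 < eta (p * p) by rewrite etap ltxx.
(* If x were in the radical of the form, p^2 would lie in J, and hence p. *)
move: xx; rewrite /= mulr1 expr2 => xx; rewrite -xx; apply: (tpos x (memvf x)) => Jx.
apply: nJp; apply: (@qradicalX _ _ _ 2); rewrite expr2 -xx -[form x x]coordsK //.
exact: Jx.
Qed.

End Separation.
End Moments.
End Polynomials.

(** * Choice of the two degrees, and the two inclusions *)

Theorem mainTheorem2 (n s : nat) (g : 'I_s -> {mpoly R[n]}) :
  exists t k : nat, leq t k /\
    forall sigma : {mpoly R[n]} -> R,
      generic_in k (Lt g (2 * k)) sigma ->
      forall f : {mpoly R[n]},
        ideal_gen (kerH t sigma) f <-> real_radical (suppQ g) f.
Proof.
pose J := qradical (QM g).
have J0 : J 0 := qradical0 (QM1 g) (@QMM _ _ g).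
have JD p q : J p -> J q -> J (p + q) := @qradicalD _ _ _ (QM1 g) (@QMD _ _ g) (@QMM _ _ g) p q.
have JM a p : J p -> J (a * p) := @qradicalMl _ _ _ (@QMD _ _ g) (@QMM _ _ g) a p.
have [l [lJ lP]] := hilbert_basis J0 JD JM.
have [t tP] : exists t, forall f, f \in l -> degle t f.
  exists (\max_(f <- l) tdeg f)%N => f fl; apply/degle_tdeg.
  exact: (leq_bigmax_seq (F := fun f => tdeg f)).
have [k0 k0P] : exists k0, forall k, (k0 <= k)%N -> forall sigma, Lt g (2 * k) sigma ->
    forall f, f \in l -> sigma (f ^+ 2) = 0.
  elim: l {lP tP} lJ => [|f l IHl] lJ; first by exists 0%N.
  have [k1 k1P] := radical_in_kernel (lJ f (mem_head _ _)).
  have [p pl|k2 k2P] := IHl; first by apply: lJ; rewrite in_cons pl orbT.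
  exists (maxn k1 k2) => k; rewrite geq_max => /andP [k1k k2k] sigma Ls h.
  rewrite in_cons => /orP [/eqP ->|hl]; first exact: (k1P k k1k sigma Ls).
  exact: (k2P k k2k sigma Ls h hl).
exists t, (maxn t k0); split=> [|sigma [Ls gen_s] f]; first exact: leq_maxl.
set k := maxn t k0 in Ls gen_s *; have tk : (t <= k)%N by exact: leq_maxl.
split=> [[c [cP ->]]|/real_radicalE Jf]; last first.
  have [c [cl ->]] := lP f Jf; exists c; split=> // x /cl xl.
  have xk : degle k x.2 by apply: degleW tk _; exact: tP.
  (* Membership in the kernel at level k passes to level t, where there are fewer test
     polynomials. *)
  have [_ H] := Lt_kerH Ls xk (k0P k (leq_maxr _ _) sigma Ls _ xl).
  by split=> [|q qt]; [exact: tP|apply: H; exact: degleW tk qt].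
apply/real_radicalE; rewrite big_seq.
apply: (big_ind J) => // x xc; apply: JM.
have [eta [Le etaP]] := truncated_functional g k.
(* Genericity puts the kernel element in the kernel of eta; paired with itself there, it gives
   eta(p^2) = 0. *)
have [xt H] := gen_s t eta tk Le _ (cP x xc).
by apply: etaP; [exact: degleW tk xt|exact: H].
Qed.
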